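(* Let $(T,\mathscr{T},\mu)$ be a measure space with $\mu(T)=1$, and let $X=\{X(t): t\in T\}$ be a real-valued measurable random field on a probability space $(\Omega,\mathscr{F},\mathbb{P})$. Let $G$ be a family of measurable transformations $g:T\to T$, endowed with a $\sigma$-algebra $\mathscr{G}$ such that $\{g\in G: g(t)\in B\}\in\mathscr{G}$ for any $t\in T$ and $B\in\mathscr{T}$. Suppose that $X_g\stackrel{d}{=}X$ and $\mu_g=\mu$ for any $g\in G$, and that there exists a probability measure $\nu$ on $(G,\mathscr{G})$ such that, for some fixed $a\in T$, $$\nu\bigl(g\in G: g(a)\in B\bigr)=\mu(B),\quad B\in\mathscr{T}.$$ If the function $x\mapsto F_\mu(X,x)$ is continuous on $\mathbb{R}$ almost surely, then the random variable $F_\mu(X,X(a))$ is uniformly distributed on $(0,1)$, i.e. $F_\mu(X,X(a))\sim U(0,1)$.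
   Context: A real-valued measurable random field $X=\{X(t):t\in T\}$ on $(\Omega,\mathscr{F},\mathbb{P})$ is a map $(t,\omega)\mapsto X(t)(\omega)\in\mathbb{R}$ that is jointly measurable with respect to $\mathscr{T}\otimes\mathscr{F}$. Sojourn function: $F_\mu(X,x):=\mu\bigl(t\in T: X(t)\le x\bigr)$ for $x\in\mathbb{R}$; $F_\mu(X,X(a))$ is the random variable $\mu\bigl(t\in T: X(t)\le X(a)\bigr)$. For $g\in G$, $X_g(\cdot):=X(g(\cdot))$ denotes the random field $\{X(g(t)):t\in T\}$, and $\mu_g(\cdot):=\mu(g(\cdot))$, i.e. $\mu_g(B)=\mu(g(B))$ where $g(B)$ is the image of $B$ under $g$. The condition $\mu_g=\mu$ means that for every $B\in\mathscr{T}$ one has $g(B)\in\mathscr{T}$ and $\mu(g(B))=\mu(B)$. $X_g\stackrel{d}{=}X$ means that the random fields $X_g$ and $X$ have the same distribution (equivalently, the same finite-dimensional distributions). *)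

(* Defs.v *)
From mathcomp Require Import all_boot all_order all_algebra.
From mathcomp Require Import all_classical all_reals all_analysis.

Set Implicit Arguments.
Unset Strict Implicit.
Unset Printing Implicit Defensive.

Import Order.TTheory GRing.Theory Num.Theory.
Import numFieldNormedType.Exports.

Local Open Scope classical_set_scope.
Local Open Scope ring_scope.

Definition measurable_field d d' (T : measurableType d) (Omega : measurableType d')
    (R : realType) (X : T -> Omega -> R) : Prop :=
  measurable_fun [set: T * Omega] (fun z : T * Omega => X z.1 z.2).

(* The product sigma-algebra on R^T, generated by the coordinate maps. *)
Definition path_sigma_algebra (T : Type) (R : realType) : set (set (T -> R)) :=
  <<s \bigcup_(t in [set: T])
        preimage_set_system [set: T -> R] (fun f : T -> R => f t) measurable >>.

(* Equality of the laws of the sample paths, as measures on R^T. *)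
Definition same_distribution d' (T : Type) (Omega : measurableType d')
    (R : realType) (P : probability Omega R) (X Y : T -> Omega -> R) : Prop :=
  forall A : set (T -> R), path_sigma_algebra A ->
    P [set w | A (fun t => X t w)] = P [set w | A (fun t => Y t w)].

(* The measured set is a section of a measurable set when X is a measurable
   field, so [fine] is only the coercion from [0, 1] to the reals. *)
Definition sojourn d d' (T : measurableType d) (Omega : measurableType d')
    (R : realType) (mu : probability T R) (X : T -> Omega -> R)
    (x : R) (w : Omega) : R :=
  fine (mu [set t | X t w <= x]).

(* mu_g = mu, with mu_g defined through direct images: mu_g B = mu (g B). *)
Definition image_invariant d (T : measurableType d) (R : realType)
    (mu : probability T R) (g : T -> T) : Prop :=
  forall B : set T, measurable B ->
    measurable (g @` B) /\ mu (g @` B) = mu B.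

(* Main.v *)
(* Put V(t, w) := F_mu(X(., w), X(t, w)), so that U := V(a, .) is the variable
   of interest.  Since g preserves mu, X_g has the sojourn function of X, and
   V(g a, .) is therefore obtained from X_g as U is from X.  Sample paths need
   not be measurable functionals of the path sigma-algebra, so equality in law
   is transferred through the moments: E U^n is the mu^n-average of
   P(X(t_1) <= X(a), ..., X(t_n) <= X(a)), which only involves
   finite-dimensional laws.  Averaging E V(g a, .)^n = E U^n over nu, U has the
   moments of V under mu x P.  When F_mu(X, .) is continuous, V(., w) is uniform
   under mu, hence V is uniform under mu x P.  Finally moments determine a law
   on [0, 1], because the polynomials (1 - u^n)^m with m = floor(s^-n) converge
   to the indicator of u < s away from s. *)
Require Import Defs.
From HB Require Import structures.
From mathcomp Require Import all_boot all_order all_algebra.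
From mathcomp Require Import all_classical all_reals all_analysis.
From mathcomp Require Import measurable_realfun ring.

Set Implicit Arguments.
Unset Strict Implicit.
Unset Printing Implicit Defensive.

Import Order.TTheory GRing.Theory Num.Theory.
Import numFieldNormedType.Exports.

Local Open Scope classical_set_scope.
Local Open Scope ring_scope.

(** * Polynomial approximation of a step function on [0, 1] *)

Lemma bernoulli_ge (R : realDomainType) (x : R) (m : nat) :
  -1 <= x -> 1 + x *+ m <= (1 + x) ^+ m.
Proof.
move=> x1; elim: m => [|m IH]; first by rewrite mulr0n addr0 expr0.
rewrite exprS mulrS -mulr_natr; apply: le_trans (ler_wpM2l _ IH); last first.
  by rewrite addrC -lerBlDr sub0r.
rewrite -mulr_natr -subr_ge0 [leRHS](_ : _ = x ^+ 2 * m%:R); last by ring.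
by rewrite mulr_ge0 ?sqr_ge0.
Qed.

(** With [c < s < d] and m the integer part of s^-n, Bernoulli's inequality gives (1 - u^n)^m >= 1 -
    m u^n >= 1 - (c/s)^n for u <= c, and (1 - u^n)^m <= 1 / (1 + m u^n) <= (s/d)^n for u >= d. *)
Lemma step_poly (R : realType) (c d e : R) : 0 < c -> c < d -> d <= 1 -> 0 < e ->
  exists p : {poly R}, forall u, 0 <= u <= 1 ->
    [/\ 0 <= p.[u] <= 1, u <= c -> 1 - e <= p.[u] & d <= u -> p.[u] <= e].
Proof.
move=> c0 cd d1 e0.
have [s cs sd] : exists2 s, c < s & s < d.
  by exists ((c + d) / 2); rewrite midf_lt.
have s0 : 0 < s := lt_trans c0 cs; have d0 : 0 < d := lt_trans s0 sd.
(* Taking the larger ratio lets one exponent [n] serve both bounds. *)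
pose q := Num.max (c / s) (s / d).
have [c0' s0' d0'] : [/\ 0 <= c, 0 <= s & 0 <= d] by split; exact: ltW.
have q0 : 0 <= q by rewrite /q le_max !divr_ge0.
have [n qn] : exists n, q ^+ n <= e.
  have q1 : `|q| < 1 by rewrite ger0_norm // /q gt_max !ltr_pdivrMr // !mul1r cs.
  have /cvgrPdist_le/(_ _ e0)[n _ /(_ n (leqnn n))] := cvg_expr q1.
  by rewrite /= sub0r normrN ger0_norm ?exprn_ge0 // => ?; exists n.
pose m := Num.truncn (s ^- n).
have /andP[m1 m2] : m%:R <= s ^- n < m.+1%:R.
  by apply: truncn_itv; rewrite invr_ge0 exprn_ge0.
exists ((1 - 'X ^+ n) ^+ m) => u /andP[u0 u1].
rewrite !hornerE.
have un0 : 0 <= u ^+ n by exact: exprn_ge0.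
have un1 : u ^+ n <= 1 by exact: exprn_ile1.
have v0 : 0 <= 1 - u ^+ n by rewrite subr_ge0.
split.
- by rewrite exprn_ge0 //= exprn_ile1 // gerBl.
- move=> uc; apply: (@le_trans _ _ (1 - u ^+ n *+ m)); last first.
    by rewrite -mulNrn; apply: bernoulli_ge; rewrite lerN2.
  rewrite lerD2l lerN2 -mulr_natr; apply: le_trans qn.
  apply: (@le_trans _ _ ((c / s) ^+ n)).
    rewrite expr_div_n ler_pM // ?lerXn2r // ltW.
  by rewrite lerXn2r // ?nnegrE ?divr_ge0 // /q le_max lexx.
- move=> du; apply: le_trans qn.
  apply: (@le_trans _ _ ((s / d) ^+ n)); last first.
    by rewrite lerXn2r // ?nnegrE ?divr_ge0 // /q le_max lexx orbT.
  have b0 : 0 < 1 + u ^+ n *+ m.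
    by rewrite ltr_wpDr // mulrn_wge0.
  apply: (@le_trans _ _ ((1 + u ^+ n *+ m)^-1)).
    rewrite -[leRHS]mul1r ler_pdivlMr //.
    (* Bernoulli is applied to 1 + u^n because (1 - u^n)(1 + u^n) = 1 - u^(2n) <= 1. *)
    apply: (@le_trans _ _ ((1 - u ^+ n) ^+ m * (1 + u ^+ n) ^+ m)).
      rewrite ler_wpM2l ?exprn_ge0 //; apply: bernoulli_ge.
      by rewrite (le_trans _ un0) // oppr_le0.
    rewrite -exprMn -subr_sqr expr1n exprn_ile1 ?gerBl ?sqr_ge0 //.
    by rewrite subr_ge0 exprn_ile1.
  rewrite -[leRHS]invrK lef_pV2 ?posrE ?invr_gt0 ?exprn_gt0 ?divr_gt0 //.
  rewrite -exprVn invf_div expr_div_n.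
  (* This uses s^-n < m + 1; the extra d^n is then absorbed by the constant 1, as [d <= 1]. *)
  apply: (@le_trans _ _ (d ^+ n * m.+1%:R)).
    by rewrite ler_wpM2l ?exprn_ge0 // ltW.
  rewrite -natr1 mulrDr mulr1 addrC lerD ?exprn_ile1 ?(ltW d0) //.
  by rewrite mulr_natr lerMn2r lerXn2r ?orbT // nnegrE ltW.
Qed.

(** * Comparison of laws on [0, 1] through moments *)

Lemma integral_horner d (T : measurableType d) (R : realType)
    (P : probability T R) (U : T -> R) (p : {poly R}) :
  measurable_fun setT U -> (forall x, 0 <= U x <= 1) ->
  (\int[P]_x (p.[U x])%:E =
   \sum_(i < size p) (p`_i)%:E * \int[P]_x (U x ^+ i)%:E)%E.
Proof.
move=> mU U01.
have iX n : P.-integrable setT (fun x => (U x ^+ n)%:E).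
  apply: (@measurable_bounded_integrable _ _ _ _ (fun x => U x ^+ n)) => //.
  - by rewrite (le_lt_trans (probability_le1 _ _)) ?ltry.
  - exact: measurable_funX.
  - exists 1; split; first exact: num_real.
    move=> M M1 x _ /=; have /andP[U0 U1] := U01 x.
    by rewrite ger0_norm ?exprn_ge0 // (le_trans _ (ltW M1)) // exprn_ile1.
under eq_integral => x _ do rewrite horner_coef -sumEFin.
have iZ (i : nat) : P.-integrable setT (fun x => (p`_i * U x ^+ i)%:E).
  by under eq_fun do rewrite EFinM; exact: integrableZl.
rewrite (@integral_sum _ _ _ _ _ _ _
  (fun (i : 'I__) x => (p`_i * U x ^+ i)%:E)) //.
by apply: eq_bigr => i _; under eq_integral do rewrite EFinM; rewrite integralZl.
Qed.

(** The indicator of [U <= c] lies below [q.[U]], while [q.[V]] lies below [e] plus the indicator of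
    [V <= d]; the integrals of [q.[U]] and [q.[V]] agree because they are combinations of moments.
    Between [c] and [d] the step polynomial is only known to lie in [0, 1], hence the gap. *)
Lemma moments_le d1 d2 (T1 : measurableType d1) (T2 : measurableType d2)
    (R : realType) (P1 : probability T1 R) (P2 : probability T2 R)
    (U : T1 -> R) (V : T2 -> R) (c d : R) :
  measurable_fun setT U -> measurable_fun setT V ->
  (forall x, 0 <= U x <= 1) -> (forall y, 0 <= V y <= 1) ->
  (forall n, \int[P1]_x (U x ^+ n)%:E = \int[P2]_y (V y ^+ n)%:E)%E ->
  0 < c -> c < d -> d <= 1 ->
  (P1 [set x | (U x <= c)%R] <= P2 [set y | (V y <= d)%R])%E.
Proof.
move=> mU mV U01 V01 UV c0 cd dle1; apply/lee_addgt0Pr => e e0.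
have [p Hp] := step_poly c0 cd dle1 (divr_gt0 e0 (ltr0Sn R 1)).
(* The shift lifts the polynomial to at least 1 on u <= c; beyond [d] its value is at most e/2 +
   e/2. *)
pose q := p + (e / 2)%:P.
have mq d' (T' : measurableType d') (W : T' -> R) : measurable_fun setT W ->
    measurable_fun setT (fun x => (q.[W x])%:E).
  move=> mW; apply/measurable_EFinP.
  apply: (@measurableT_comp _ _ _ _ _ _ (horner q) _ W) => //; exact: measurable_poly.
have mle d' (T' : measurableType d') (W : T' -> R) b : measurable_fun setT W ->
    measurable [set x | W x <= b].
  by move=> mW; rewrite -[X in measurable X]setTI; exact: measurable_fun_le.
rewrite -[X in P1 X]setIT -integral_indic //; last exact: mle.
apply: (@le_trans _ _ (\int[P1]_x (q.[U x])%:E)%E).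
  apply: ge0_le_integral => //; last 1 first.
  - move=> x _; rewrite lee_fin hornerD hornerC indicE.
    have [/andP[p0 _] h _] := Hp _ (U01 x).
    case: (boolP (x \in _)) => [|_]; last by rewrite addr_ge0 // divr_ge0 // ltW.
    by rewrite inE /= => /h; rewrite lerBlDr.
  - exact/measurable_EFinP/measurable_indic/mle.
  - exact: mq.
rewrite integral_horner //; under eq_bigr do rewrite UV.
rewrite -integral_horner // -[X in P2 X]setIT -integral_indic //; last exact: mle.
have -> : e%:E = (\int[P2]_x e%:E)%E.
  by rewrite integral_cst //= probability_setT mule1.
rewrite -ge0_integralD //; last 2 first.
- exact/measurable_EFinP/measurable_indic/mle.
- by move=> x _; rewrite lee_fin ltW.
apply: ge0_le_integral => //; last first.
- move=> x _; rewrite -EFinD lee_fin hornerD hornerC indicE.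
  have [/andP[_ p1] _ h] := Hp _ (V01 x).
  case: (boolP (x \in _)) => [_|].
    by rewrite lerD // ler_pdivrMr // ler_pMr // ler1n.
  rewrite notin_setE /= => /negP; rewrite -ltNge => /ltW /h ?.
  by rewrite add0r [leRHS]splitr lerD.
- apply: emeasurable_funD => //; exact/measurable_EFinP/measurable_indic/mle.
- exact: mq.
- move=> x _; have [/andP[p0 _] _ _] := Hp _ (V01 x).
  by rewrite lee_fin hornerD hornerC addr_ge0 // divr_ge0 // ltW.
Qed.

(** * Distribution functions on the real line *)

Lemma eq_measure_cdf (R : realType) (m1 m2 : probability (measurableTypeR R) R) :
  (forall c, m1 `]-oo, c] = m2 `]-oo, c])%classic ->
  forall A, measurable A -> m1 A = m2 A.
Proof.
move=> m12 A mA.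
(* The whole line is adjoined to the pi-system of half-lines to supply the covering sequence that
   [measure_unique] asks for. *)
pose G := [set A : set (measurableTypeR R) | A = setT \/ exists x, A = `]-oo, x]%classic].
apply: (@measure_unique _ R _ G (fun=> setT) _ _ _ _ m1 m2) => //.
- apply/seteqP; split; last first.
    apply: smallest_sub; first exact: sigma_algebra_measurable.
    by move=> _ [->|[x ->]] //; exact: measurable_itv.
  rewrite (RGenOInfty.measurableE R).
  apply: smallest_sub; first exact: smallest_sigma_algebra.
  move=> _ [x ->]; rewrite -setCitvl; apply: (@measurableC _ (g_sigma_algebraType G)).
  by apply: sub_sigma_algebra; right; exists x.
- move=> _ _ [->|[x ->]] [->|[y ->]]; rewrite ?setTI ?setIT.
  + by left.
  + by right; exists y.
  + by right; exists x.
  + right; exists (Num.min x y).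
    apply/seteqP; split=> z /=; rewrite !in_itv /= le_min; last by move/andP.
    by case=> -> ->.
- by move=> _; left.
- by rewrite bigcup_const.
- by move=> _ [->|[x ->]]; rewrite ?m12 //= !probability_setT.
- by move=> _ /=; rewrite probability_setT ltry.
Qed.

(** Probability integral transform: by continuity every level in (0, 1) is attained at some [x], and
    monotonicity then compares events on [F (Y t)] with events [Y t <= x]. *)
Lemma continuous_cdf_uniform d (T : measurableType d) (R : realType)
    (mu : probability T R) (Y : {RV mu >-> R}) (c : R) :
  continuous (fun x => fine (cdf Y x)) -> 0 < c < 1 ->
  (mu [set t | (fine (cdf Y (Y t)) <= c)%R] = c%:E)%E.
Proof.
move=> Fc; pose F x := fine (cdf Y x).
have cdfE x : mu [set t | Y t <= x] = (F x)%:E.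
  have -> : [set t | Y t <= x] = Y @^-1` `]-oo, x].
    by apply/seteqP; split => t /=; rewrite in_itv.
  by rewrite fineK ?fin_num_measure.
have Fnd : {homo F : x y / x <= y}.
  by move=> x y xy; rewrite fine_le ?fin_num_measure // cdf_nondecreasing.
have mle x : measurable [set t | Y t <= x].
  by rewrite -[X in measurable X]setTI; exact: measurable_fun_le.
have mFle x : measurable [set t | F (Y t) <= x].
  rewrite -[X in measurable X]setTI; apply: measurable_fun_le => //.
  by apply: measurableT_comp => //; exact: continuous_measurable_fun.
have Fsurj b : 0 < b < 1 -> exists x, F x = b.
  move=> /andP[b0 b1].
  have [l Fl] : exists l, F l < b.
    have : F x @[x --> -oo] --> (0 : R) by exact: fine_cvg (cvg_cdfNy0 Y).
    move=> /cvgrPdist_lt/(_ _ b0)[l [_ Hl]].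
    exists (l - 1); have := Hl (l - 1); rewrite /= sub0r normrN ger0_norm.
      by apply; rewrite ltrBlDr ltrDl.
    by rewrite fine_ge0 // cdf_ge0.
  have [r Fr] : exists r, b < F r.
    have b1' : 0 < 1 - b by rewrite subr_gt0.
    have : F x @[x --> +oo] --> (1 : R) by exact: fine_cvg (cvg_cdfy1 Y).
    move=> /cvgrPdist_lt/(_ _ b1')[r [_ Hr]].
    exists (r + 1); have := Hr (r + 1); rewrite /= ltrDl => /(_ ltr01).
    by move/(le_lt_trans (ler_norm _)); rewrite ltrD2l ltrN2.
  have lr : l <= r.
    by case: (leP l r) => // /ltW /Fnd; rewrite leNgt (lt_trans Fl Fr).
  have [|x _ Fx] := @IVT R F l r b lr (continuous_subspaceT Fc).
    by rewrite ge_min le_max (ltW Fl) (ltW Fr) orbT.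
  by exists x.
move=> c01; apply/eqP; rewrite eq_le; apply/andP; split.
  (* [F] may stay at the level [c] to the right of a point [x] with [F x = c], so [F (Y t) <= c]
     need not force [Y t <= x]. It does once [F x = c + e]. *)
  apply/lee_addgt0Pr => e e0.
  have [ce1|ce1] := leP 1 (c + e).
    by rewrite (le_trans (probability_le1 _ _)) // -EFinD lee_fin.
  have /Fsurj[x Fx] : 0 < c + e < 1.
    by rewrite ce1 addr_gt0 //; case/andP: c01.
  rewrite -EFinD -Fx -cdfE le_measure ?inE //.
  move=> t /= Ft; rewrite leNgt; apply/negP => /ltW /Fnd.
  by rewrite Fx => /le_trans/(_ Ft); rewrite gerDl leNgt e0.
have [x Fx] := Fsurj _ c01.
rewrite -Fx -cdfE le_measure ?inE //; last by move=> t /=; exact: Fnd.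
Qed.

(** * Invariance and measurability of the sojourn function *)

(** Invariance under direct images passes to preimages: g(g^-1 A) is the part of A inside the range
    of [g], and this range has measure mu(T) = 1. *)
Lemma sojourn_image_invariant d d' (T : measurableType d)
    (Omega : measurableType d') (R : realType) (mu : probability T R)
    (X : T -> Omega -> R) (g : T -> T) :
  measurable_field X -> measurable_fun setT g -> image_invariant mu g ->
  forall x, sojourn mu (fun t => X (g t)) x = sojourn mu X x.
Proof.
move=> mX mg gmu x; apply/funext => w; congr fine.
have mA : measurable [set t | X t w <= x].
  rewrite -[X in measurable X]setTI; apply: measurable_fun_le => //.
  exact: (measurable_fun_pair1 w mX).
have [mT muT] := gmu _ measurableT; rewrite probability_setT in muT.
set A := [set t | X t w <= x] in mA *.
have mgA : measurable (g @^-1` A).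
  by rewrite -[X in measurable X]setTI; exact: mg.
transitivity (mu (g @` (g @^-1` A))); first by rewrite (gmu _ mgA).2.
rewrite [X in mu X](_ : _ = A `&` range g); last first.
  apply/seteqP; split=> [s [t At <-]|s [At [t _ gt]]] /=.
    by split=> //; exists t.
  by exists t => //=; rewrite gt.
suff D0 : mu (A `\` range g) = 0%E.
  transitivity (mu (A `\` range g) + mu (A `&` range g))%E.
    by rewrite D0 add0e.
  exact/esym/measureDI.
apply/eqP; rewrite -measure_le0.
rewrite (_ : 0%E = mu (~` range g)); last by rewrite probability_setC // muT subee.
apply: le_measure; rewrite ?inE; [exact: measurableD|exact: measurableC|].
by move=> t [].
Qed.

(** The value at [z] is the measure of the [z]-section of a measurable subset of (T x Omega) x T. *)
Lemma measurable_sojourn d d' (T : measurableType d)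
    (Omega : measurableType d') (R : realType) (mu : probability T R)
    (X : T -> Omega -> R) : measurable_field X ->
  measurable_fun [set: T * Omega] (fun z => sojourn mu X (X z.1 z.2) z.2).
Proof.
move=> mX.
pose S := [set z : (T * Omega) * T | X z.2 z.1.2 <= X z.1.1 z.1.2].
have mS : measurable S.
  rewrite -[X in measurable X]setTI; apply: measurable_fun_le => //.
  - apply: (measurableT_comp mX (g := fun z : (T * Omega) * T => (z.2, z.1.2))).
    apply: measurable_fun_pair => //; exact: measurableT_comp.
  - apply: (measurableT_comp mX (g := fun z : (T * Omega) * T => z.1)).
    exact: measurable_fst.
apply: (@measurableT_comp _ _ _ _ _ _ fine) => //.
apply: (eq_measurable_fun (mu \o xsection S)).
  move=> z _ /=; congr (mu _).
  by apply/seteqP; split => t /=; rewrite /xsection /= inE.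
exact: measurable_fun_xsection.
Qed.

Lemma sojourn_itv01 d d' (T : measurableType d) (Omega : measurableType d')
    (R : realType) (mu : probability T R) (X : T -> Omega -> R) x w :
  measurable_field X -> 0 <= sojourn mu X x w <= 1.
Proof.
move=> mX; have mA : measurable [set t | X t w <= x].
  rewrite -[X in measurable X]setTI; apply: measurable_fun_le => //.
  exact: (measurable_fun_pair1 w mX).
by rewrite fine_ge0 //= -lee_fin fineK ?fin_num_measure ?probability_le1.
Qed.

(** * Moments and equality in law *)

(** The event depends on finitely many coordinates, so [same_distribution] applies to it
    directly. *)
Lemma path_measurable_all (T : Type) (R : realType) (a : T) (s : seq T) :
  path_sigma_algebra [set f : T -> R | all (fun t => f t <= f a) s].
Proof.
pose G := \bigcup_(t in [set: T])
  preimage_set_system [set: T -> R] (fun f : T -> R => f t) measurable.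
have mev t : measurable_fun setT (fun f : g_sigma_algebraType G => f t : R).
  move=> _ B mB; apply: sub_sigma_algebra; exists t => //.
  by exists B.
have mall : measurable_fun setT
    (fun f : g_sigma_algebraType G => all (fun t => (f t : R) <= f a) s).
  elim: s => [|t s IH] /=; first exact: measurable_cst.
  by apply: measurable_and => //; exact: measurable_fun_ler.
have := mall measurableT [set true] Logic.I.
by rewrite setTI.
Qed.

Section moments.
Context d d' (T : measurableType d) (Omega : measurableType d') (R : realType).
Variables (mu : probability T R) (P : probability Omega R) (a : T).

Let rank (X : T -> Omega -> R) w := sojourn mu X (X a w) w.
(** The list [s] accumulates the points already extracted from the power of [rank]. *)
Let below (X : T -> Omega -> R) (s : seq T) w : R :=
  (all (fun t => X t w <= X a w) s)%:R.

Let measurable_rank X : measurable_field X -> measurable_fun setT (rank X).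
Proof.
by move=> mX; exact: (measurable_fun_pair2 a (measurable_sojourn mu mX)).
Qed.

Let measurable_natr_bool d0 (S : measurableType d0) (b : S -> bool) :
  measurable_fun setT b -> measurable_fun setT (fun x => (b x)%:R : R).
Proof.
move=> mb.
by apply: (@measurableT_comp _ _ _ _ _ _ (fun b : bool => b%:R : R) _ b).
Qed.

Let measurable_all (X : T -> Omega -> R) s : measurable_field X ->
  measurable_fun setT (fun w => all (fun t => X t w <= X a w) s).
Proof.
move=> mX; elim: s => [|t s IH] /=; first exact: measurable_cst.
by apply: measurable_and => //; apply: measurable_fun_ler;
  exact: (measurable_fun_pair2 _ mX).
Qed.

(* Unfolding one factor of the n-th moment as an average over t of the indicator
   of X(t) <= X(a) adds t to the list; at n = 0 only finitely many coordinates
   of the path are left. *)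
Let moment_succ X n s : measurable_field X ->
  (\int[P]_w (rank X w ^+ n.+1 * below X s w)%:E =
   \int[mu]_t \int[P]_w (rank X w ^+ n * below X (t :: s) w)%:E)%E.
Proof.
move=> mX.
have mXa : measurable_fun setT (X a) by exact: (measurable_fun_pair2 _ mX).
have mXw w : measurable_fun setT (X^~ w) by exact: (measurable_fun_pair1 w mX).
have r0 w : 0 <= rank X w by case/andP: (sojourn_itv01 mu (X a w) w mX).
pose h z := (rank X z.2 ^+ n * below X (z.1 :: s) z.2)%:E.
have mh : measurable_fun [set: T * Omega] h.
  apply/measurable_EFinP; apply: measurable_funM.
    apply: measurable_funX; apply: (measurableT_comp (measurable_rank mX)).
    exact: measurable_snd.
  apply: measurable_natr_bool => /=; apply: measurable_and.
    apply: measurable_fun_ler => //.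
    by apply: (measurableT_comp mXa); exact: measurable_snd.
  by apply: (measurableT_comp (measurable_all s mX)); exact: measurable_snd.
have h0 z : (0 <= h z)%E by rewrite lee_fin mulr_ge0 // exprn_ge0.
transitivity (\int[P]_w \int[mu]_t h (t, w))%E; last first.
  exact/esym/(fubini_tonelli h mh h0).
apply: eq_integral => w _.
(* For fixed [w] only the indicator depends on [t], and its integral is the missing factor
   [rank X w]. *)
transitivity (\int[mu]_t ((rank X w ^+ n * below X s w)%:E *
    (\1_[set t | (X t w <= X a w)%R] t)%:E))%E; last first.
  apply: eq_integral => t _; rewrite -EFinM /h /= /below /= -mulnb natrM.
  rewrite -mulrA; congr (_ * _)%:E; rewrite mulrC indicE; congr (_%:R * _).
  by congr nat_of_bool; apply/idP/idP; rewrite inE.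
have mle : measurable [set t | X t w <= X a w].
  by rewrite -[X in measurable X]setTI; exact: measurable_fun_le.
rewrite ge0_integralZl_EFin //.
- rewrite integral_indic // setIT exprSr -mulrA [_ * below _ _ _]mulrC mulrA.
  rewrite EFinM.
  by rewrite /rank /sojourn fineK // fin_num_measure.
- exact/measurable_EFinP/measurable_indic.
- by rewrite mulr_ge0 // exprn_ge0.
Qed.

(** The list is arbitrary because each induction step lengthens it; at n = 0 both sides are
    probabilities of one path event. *)
Let moment_below X Y n s : measurable_field X -> measurable_field Y ->
  same_distribution P X Y ->
  (\int[P]_w (rank X w ^+ n * below X s w)%:E =
   \int[P]_w (rank Y w ^+ n * below Y s w)%:E)%E.
Proof.
move=> mX mY XY; elim: n s => [|n IH] s; last first.
  by rewrite !moment_succ //; apply: eq_integral => t _; exact: IH.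
have E Z : measurable_field Z -> (\int[P]_w (rank Z w ^+ 0 * below Z s w)%:E =
    P [set w | all (fun t => (Z t w <= Z a w)%R) s])%E.
  move=> mZ; rewrite -[X in P X]setIT -integral_indic //; last first.
    have mall := measurable_all s mZ.
    by have := mall measurableT [set true] Logic.I; rewrite setTI.
  apply: eq_integral => w _; rewrite expr0 mul1r indicE; congr (_%:R)%:E.
  by congr nat_of_bool; apply/idP/idP; rewrite inE.
by rewrite !E //; exact: XY (path_measurable_all a s).
Qed.

Lemma moment_same_distribution X Y n :
  measurable_field X -> measurable_field Y -> same_distribution P X Y ->
  (\int[P]_w (sojourn mu X (X a w) w ^+ n)%:E =
   \int[P]_w (sojourn mu Y (Y a w) w ^+ n)%:E)%E.
Proof.
move=> mX mY XY; have := moment_below n [::] mX mY XY.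
by under eq_integral do rewrite mulr1; under [in RHS]eq_integral do rewrite mulr1.
Qed.

End moments.

(** * The uniform law: recovery from moments and distribution function *)

Lemma moments_uniform d1 d2 (T1 : measurableType d1) (T2 : measurableType d2)
    (R : realType) (P1 : probability T1 R) (P2 : probability T2 R)
    (U : T1 -> R) (V : T2 -> R) (c : R) :
  measurable_fun setT U -> measurable_fun setT V ->
  (forall x, 0 <= U x <= 1) -> (forall y, 0 <= V y <= 1) ->
  (forall n, \int[P1]_x (U x ^+ n)%:E = \int[P2]_y (V y ^+ n)%:E)%E ->
  (forall d, 0 < d < 1 -> P2 [set y | V y <= d] = d%:E) ->
  0 <= c < 1 -> P1 [set x | U x <= c] = c%:E.
Proof.
move=> mU mV U01 V01 UV Vu /andP[c0 c1].
have mle d : measurable [set x | U x <= d].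
  by rewrite -[X in measurable X]setTI; exact: measurable_fun_le.
apply/eqP; rewrite eq_le; apply/andP; split; apply/lee_addgt0Pr => e e0.
  rewrite -EFinD; have [ce1|ce1] := leP 1 (c + e).
    by rewrite (le_trans (probability_le1 _ _)).
  rewrite -Vu; last by rewrite ce1 andbT ltr_wpDl.
  (* [moments_le] wants a positive lower threshold, and [c] may be 0, so the comparison starts from
     c + e/2. *)
  have ce : c < c + e / 2 by rewrite ltrDl divr_gt0.
  apply: (@le_trans _ _ (P1 [set x | U x <= c + e / 2])).
    by rewrite le_measure ?inE // => x /= /le_trans; apply; exact: ltW.
  apply: moments_le => //; last exact: ltW.
  - by rewrite (le_lt_trans c0).
  - by rewrite ltrD2l ltr_pdivrMr // ltr_pMr // ltr1n.
have [ec|ce] := leP c e.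
  by rewrite (@le_trans _ _ e%:E) // leeDr.
(* Here c - e lies in (0, 1), and [moments_le] is used with the two variables exchanged. *)
rewrite -leeBlDr // -EFinB -Vu; last first.
  by rewrite subr_gt0 ce /= (lt_trans _ c1) // ltrBlDr ltrDl.
apply: moments_le => //.
- by rewrite subr_gt0.
- by rewrite ltrBlDr ltrDl.
- exact: ltW.
Qed.

Lemma uniform_prob_itvNyc (R : realType) (c : R) :
  uniform_prob (@ltr01 R) `]-oo, c]%classic = (Num.max 0 (Num.min c 1))%:E.
Proof.
rewrite /uniform_prob integral_uniform_pdf.
have [c0|c0] := ltP c 0.
  rewrite (_ : _ `&` _ = set0) ?integral_set0.
    by rewrite max_l // ge_min ltW.
  apply/seteqP; split=> // x /=; rewrite !in_itv /= => -[xc /andP[x0 _]].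
  by have := le_lt_trans (le_trans x0 xc) c0; rewrite ltxx.
rewrite max_r; last by rewrite le_min c0 ler01.
set m := Num.min c 1.
have m0 : 0 <= m by rewrite /m le_min c0 ler01.
rewrite (_ : _ `&` _ = `[0, m]%classic); last first.
  apply/seteqP; split=> x /=; rewrite !in_itv /= /m le_min.
    by move=> [-> /andP[-> ->]].
  by move=> /and3P[-> -> ->].
rewrite (eq_integral (fun=> 1%:E)); last first.
  move=> x; rewrite inE /= in_itv /= /uniform_pdf /m le_min => /and3P[-> _ ->].
  by rewrite subr0 invr1.
rewrite integral_cst //= mul1e lebesgue_measure_itv /= lte_fin.
have [_|m_le0] := ltP 0 m; first by rewrite sube0.
by congr EFin; apply/le_anti; rewrite m0 m_le0.
Qed.

Theorem theorem2 (R : realType) (dT dO dG : measure_display)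
    (T : measurableType dT) (mu : probability T R)
    (Omega : measurableType dO) (P : probability Omega R)
    (X : T -> Omega -> R) (X_meas : measurable_field X)
    (G : measurableType dG) (act : G -> {mfun T >-> T})
    (act_meas : forall (t : T) (B : set T), measurable B ->
       measurable [set g : G | B (act g t)])
    (X_inv : forall g : G, same_distribution P (fun t => X (act g t)) X)
    (mu_inv : forall g : G, image_invariant mu (act g))
    (nu : probability G R) (a : T)
    (nu_a : forall B : set T, measurable B ->
       nu [set g : G | B (act g a)] = mu B)
    (F_cont : {ae P, forall w : Omega,
       continuous (fun x : R => sojourn mu X x w)}) :
  exists U : {RV P >-> R},
    (forall w : Omega, U w = sojourn mu X (X a w) w) /\
    (forall A : set R, measurable A ->
       distribution P U A = uniform_prob (@ltr01 R) A).
Proof.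
pose V (z : T * Omega) := sojourn mu X (X z.1 z.2) z.2.
have mV : measurable_fun setT V by exact: measurable_sojourn.
have V01 z : 0 <= V z <= 1 by exact: sojourn_itv01.
pose U w := V (a, w).
have mU : measurable_fun setT U by exact: measurable_fun_pair2 mV.
have moments n :
    (\int[P]_w (U w ^+ n)%:E = \int[(mu \x P)%E]_z (V z ^+ n)%:E)%E.
  pose h z := (V z ^+ n)%:E.
  have mh : measurable_fun setT h by apply/measurable_EFinP/measurable_funX.
  have h0 z : (0 <= h z)%E.
    by rewrite lee_fin exprn_ge0 //; case/andP: (V01 z).
  have mact : measurable_fun setT (fun g => act g a).
    by move=> _ B mB; rewrite setTI; exact: act_meas.
  pose ev : {mfun G >-> T} := HB.pack (fun g => act g a)
    (@isMeasurableFun.Build _ _ _ _ (fun g => act g a) mact).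
  rewrite [RHS](fubini_tonelli1 h mh h0).
  (* By [nu_a], [mu] is the law of [ev] under [nu], so the outer integral over T becomes one over G,
     with an integrand that turns out to be constant. *)
  rewrite (eq_measure_integral (distribution nu ev)); last first.
    by move=> B mB _; exact/esym/nu_a.
  rewrite ge0_integral_pushforward //; last 2 first.
  - exact: measurable_fun_fubini_tonelli_F.
  - by move=> t _; apply: integral_ge0.
  rewrite preimage_setT (eq_integral (fun=> \int[P]_w (U w ^+ n)%:E)%E).
    by rewrite integral_cst //= probability_setT mule1.
  move=> g _ /=; rewrite /fubini_F /h /U /V /=.
  have mXg : measurable_field (fun t => X (act g t)).
    apply: (measurableT_comp X_meas (g := fun z : T * Omega => (act g z.1, z.2))).
    by apply: measurable_fun_pair => //; exact: measurableT_comp.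
  (* Equality in law yields the moment formed with the sojourn function of X_g; invariance of [mu]
     then replaces it by that of [X]. *)
  rewrite -(moment_same_distribution mu a n mXg X_meas (X_inv g)).
  by apply: eq_integral => w _; rewrite sojourn_image_invariant.
have V_unif c : 0 < c < 1 -> (mu \x P)%E [set z | V z <= c] = c%:E.
  move=> c01; set A := [set z | V z <= c].
  have mA : measurable A.
    by rewrite -[X in measurable X]setTI; exact: measurable_fun_le.
  (* Slicing at fixed [w], since continuity is available for almost every [w]. *)
  transitivity (\int[P]_w (mu \o ysection A) w)%E.
    rewrite -indic_fubini_tonelli_GE //.
    transitivity (\int[mu]_t fubini_F P (EFin \o \1_A) t)%E.
      by rewrite -indic_fubini_tonelli1 // integral_indic // setIT.
    exact: indic_fubini_tonelli.
  rewrite (ae_eq_integral (fun=> c%:E)) //.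
  - by rewrite integral_cst //= probability_setT mule1.
  - exact: measurable_fun_ysection.
  apply: filterS F_cont => w Fw _ /=.
  have mXw : measurable_fun setT (X^~ w) by exact: measurable_fun_pair1 X_meas.
  (* A sample path is a random variable on (T, mu) whose distribution function is the sojourn
     function. *)
  pose Y : {RV mu >-> R} := HB.pack (X^~ w)
    (@isMeasurableFun.Build _ _ _ _ (X^~ w) mXw).
  rewrite -(@continuous_cdf_uniform _ _ _ mu Y c) //.
  by congr (mu _); apply/seteqP; split => t; rewrite /ysection /= inE.
pose URV : {RV P >-> R} := HB.pack U (@isMeasurableFun.Build _ _ _ _ U mU).
exists URV; split=> // A mA.
(* [uniform_prob] is a measure on [measurableTypeR R], which has the
   sigma-algebra of [R] but another display. *)
pose U' : {mfun Omega >-> measurableTypeR R} :=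
  HB.pack U (@isMeasurableFun.Build _ _ _ (measurableTypeR R) U mU).
rewrite -[LHS]/(distribution P U' A).
apply: eq_measure_cdf => // c; rewrite /= uniform_prob_itvNyc.
transitivity (P [set w | U w <= c]).
  by congr (P _); apply/seteqP; split => w /=; rewrite in_itv.
have U01 w : 0 <= U w <= 1 by exact: V01.
(* Outside [0, 1) the distribution function is 0 or 1 because [U] takes values in [0, 1]. *)
have [c0|c0] := ltP c 0.
  rewrite (_ : [set w | _] = set0) ?measure0 ?max_l // ?ge_min ?(ltW c0) //.
  apply/seteqP; split=> // w /= /le_lt_trans/(_ c0).
  by case/andP: (U01 w) => /le_lt_trans h _ /h; rewrite ltxx.
have [c1|c1] := ltP c 1.
  rewrite max_r //.
  by apply: (moments_uniform mU mV U01 V01 moments V_unif); rewrite c0 c1.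
rewrite max_r // (_ : [set w | _] = setT) ?probability_setT //.
apply/seteqP; split=> // w _ /=; apply: le_trans c1.
by case/andP: (U01 w).
Qed.
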